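(* Let $1<p<\infty$ and let $f\in\mathcal{M}(\mathcal{H}(ces_p))$. Suppose that the associated operator $$g\in\mathcal{H}(ces_p)\mapsto M_f(g):=fg\in\mathcal{H}(ces_p)$$ is compact. Then $f=0$.
   Context: Let $1/p+1/q=1$ and, for $\theta\in\mathbb{R}$, $\mathbb{C}_\theta:=\{s\in\mathbb{C}:\Re(s)>\theta\}$. For $1<p<\infty$, the Ces\`aro sequence space $ces_p$ consists of all complex sequences $(a_n)_{n=1}^\infty$ with $$\|(a_n)_{n=1}^\infty\|_{ces_p}:=\Big(\sum_{n=1}^\infty\Big(\frac1n\sum_{k=1}^n|a_k|\Big)^p\Big)^{1/p}<\infty.$$ $\mathcal{H}(ces_p)$ is the Banach space of all Dirichlet series $f(s)=\sum_{n=1}^\infty a_nn^{-s}$ with $(a_n)_{n=1}^\infty\in ces_p$, with norm $\|f\|_{\mathcal{H}(ces_p)}:=\|(a_n)_{n=1}^\infty\|_{ces_p}$. Every such $f$ converges absolutely, hence is analytic, on $\mathbb{C}_{1/q}$. A multiplier on $\mathcal{H}(ces_p)$ is an analytic function $f$ on $\mathbb{C}_{1/q}$ such that $fg\in\mathcal{H}(ces_p)$ for every $g\in\mathcal{H}(ces_p)$ (pointwise product; in terms of coefficients it is the Dirichlet convolution $(a\cdot b)_n=\sum_{k|n}a_kb_{n/k}$), and $\mathcal{M}(\mathcal{H}(ces_p))$ is the set of all multipliers on $\mathcal{H}(ces_p)$. For each multiplier $f$ the operator $M_f$ is bounded on $\mathcal{H}(ces_p)$. *)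

(* Defs.v *)
From HB Require Import structures.
From mathcomp Require Import all_boot all_order all_algebra.
From mathcomp Require Import complex.
From mathcomp Require Import all_classical all_reals all_analysis.

Set Implicit Arguments.
Unset Strict Implicit.
Unset Printing Implicit Defensive.
Import Order.TTheory GRing.Theory Num.Theory.
Import numFieldNormedType.Exports.

Local Open Scope classical_set_scope.
Local Open Scope ring_scope.
Local Open Scope complex_scope.

(* R[i] with the topology of its modulus, as a normed space over itself; with
   it, [derivable f s 1] for f : R[i] -> R[i] is complex differentiability. *)
HB.instance Definition _ (R : realType) :=
  NormedModule.copy R[i] (R[i] : numFieldType).

Section complex_functions.
Context {R : realType}.
Implicit Types (s z : R[i]) (f : R[i] -> R[i]).

Definition half_plane (theta : R) : set R[i] := [set s | theta < complex.Re s].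

(* Meant for open D. *)
Definition analytic_on (D : set R[i]) f := forall s, D s -> derivable f s 1.

Definition cexp z : R[i] :=
  (expR (complex.Re z))%:C * (cos (complex.Im z) +i* sin (complex.Im z)).

(* n^(-s), meant for n >= 1. *)
Definition dirichlet_char (n : nat) s : R[i] := cexp (- s * (ln n%:R)%:C).

(* Coefficient sequences are indexed from 0: a n is the coefficient of
   (n+1)^(-s). *)
Definition dirichlet_series (a : nat -> R[i]) s : R[i] :=
  limn (series (fun n => a n * dirichlet_char n.+1 s)).

End complex_functions.

Section ces_norm.
Context {R : realType}.
Implicit Types (p : R) (a b : nat -> R[i]).

(* With the indexing from 0, this is the Cesaro mean of order n+1. *)
Definition ces_mean a (n : nat) : R :=
  n.+1%:R^-1 * \sum_(k < n.+1) Normc.normc (a k).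

Definition ces_norm p a : \bar R :=
  ((\sum_(n <oo) (ces_mean a n `^ p)%:E) `^ p^-1)%E.

Lemma normc_ge0 (z : R[i]) : 0 <= Normc.normc z.
Proof. by case: z => x y /=; exact: sqrtr_ge0. Qed.

Lemma ces_mean_ge0 a n : 0 <= ces_mean a n.
Proof.
by rewrite mulr_ge0 ?invr_ge0 ?ler0n// sumr_ge0// => k _; exact: normc_ge0.
Qed.

Lemma ces_meanD a b n :
  ces_mean (fun k => a k + b k) n <= ces_mean a n + ces_mean b n.
Proof.
rewrite /ces_mean -mulrDr ler_wpM2l ?invr_ge0 ?ler0n// -big_split/=.
by apply: ler_sum => k _; exact: le_normcD.
Qed.

Lemma ces_meanZ (c : R[i]) a n :
  ces_mean (fun k => c * a k) n = Normc.normc c * ces_mean a n.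
Proof.
rewrite /ces_mean mulrCA; congr (_ * _); rewrite big_distrr/=.
by apply: eq_bigr => k _; rewrite Normc.normcM.
Qed.

Lemma ces_norm_ge0 p a : (0 <= ces_norm p a)%E.
Proof. exact: poweR_ge0. Qed.

Lemma ces_norm_Lnorm p a : 0 < p ->
  ces_norm p a = 'N[counting]_p%:E[EFin \o ces_mean a]%E.
Proof.
move=> p0; rewrite Lnorm_counting//; congr poweR.
apply: eq_eseriesr => n _ /=.
by rewrite ger0_norm ?ces_mean_ge0.
Qed.

Lemma ces_normD p a b : 1 <= p ->
  (ces_norm p (fun k => a k + b k)%R <= ces_norm p a + ces_norm p b)%E.
Proof.
move=> p1; have p0 : 0 < p := lt_le_trans ltr01 p1.
rewrite (ces_norm_Lnorm a)// (ces_norm_Lnorm b)//.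
apply: le_trans (minkowski_EFin counting (f := ces_mean a) (g := ces_mean b) _ _ p1) => //.
  rewrite Lnorm_counting//; apply: gt0_ler_poweR.
  - by rewrite invr_ge0 ltW.
  - by rewrite in_itv/= leey andbT nneseries_ge0// => n *; rewrite lee_fin powR_ge0.
  - by rewrite in_itv/= leey andbT nneseries_ge0// => n *; rewrite poweR_ge0.
  apply: lee_nneseries => n *; first by rewrite lee_fin powR_ge0.
  rewrite /= lee_fin ge0_ler_powR ?(ltW p0) ?nnegrE ?ces_mean_ge0//.
  by rewrite (le_trans (ces_meanD _ _ _))// ler_norm.
Qed.

Lemma ces_normZ p (c : R[i]) a : 0 < p ->
  ces_norm p (fun k => c * a k) = ((Normc.normc c)%:E * ces_norm p a)%E.
Proof.
move=> p0; rewrite /ces_norm.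
under eq_eseriesr do
  rewrite ces_meanZ powRM ?normc_ge0 ?ces_mean_ge0// EFinM.
rewrite nneseriesZl; last by move=> n _; rewrite lee_fin powR_ge0.
rewrite poweRM ?lee_fin ?powR_ge0//; last first.
  by apply: nneseries_ge0 => n *; rewrite lee_fin powR_ge0.
by rewrite poweR_EFin -powRrM mulfV ?gt_eqF// powRr1 ?normc_ge0.
Qed.

Lemma ces_norm_eq0 p a : ces_norm p a = 0%E -> forall n, a n = 0.
Proof.
have tge0 n : (0 <= (ces_mean a n `^ p)%:E)%E by rewrite lee_fin powR_ge0.
move=> /poweR_eq0_eq0 => /(_ (nneseries_ge0 (fun n _ _ => tge0 n))) S0 n.
have : ((ces_mean a n `^ p)%:E <= \sum_(n <oo) (ces_mean a n `^ p)%:E)%E.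
  apply: le_trans (nneseries_lim_ge n.+1 (fun n _ _ => tge0 n)).
  by rewrite big_nat_recr//= leeDr// sume_ge0.
rewrite S0 lee_fin => tle0.
have /powR_eq0_eq0 m0 : ces_mean a n `^ p = 0.
  by apply/eqP; rewrite eq_le powR_ge0 andbT.
have /eqP : \sum_(k < n.+1) Normc.normc (a k) = 0.
  by apply/eqP; move: m0 => /eqP; rewrite mulf_eq0 invr_eq0 pnatr_eq0.
rewrite psumr_eq0; last by move=> k _; exact: normc_ge0.
move=> /allP/(_ ord_max (mem_index_enum _))/= /eqP.
exact: Normc.eq0_normc.
Qed.

Definition ces p : {pred nat -> R[i]} := mem [set a | (ces_norm p a < +oo)%E].

End ces_norm.

(* H(ces_p): a Dirichlet series is represented by its coefficient sequence;
   the function it defines is dirichlet_series of that sequence. The parameter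
   p1 is there for the normed space structure on this type. *)
Record ces_dirichlet (R : realType) (p : R) (p1 : 1 < p) := CesDirichlet {
  coef :> nat -> R[i];
  coef_ces : coef \in ces p }.

Section ces_dirichlet_normedModType.
Context {R : realType} {p : R} (p1 : 1 < p).
Local Notation ces_dirichlet := (ces_dirichlet p1).

HB.instance Definition _ := [isSub for @coef R p p1].
HB.instance Definition _ := [Choice of ces_dirichlet by <:].

Lemma ces_submod_closed : submod_closed (ces p : {pred nat -> R[i]}).
Proof.
have p0 : 0 < p := lt_trans ltr01 p1.
split.
  rewrite inE/= (_ : 0 = fun k : nat => 0 * (0 : R[i])).
    by rewrite ces_normZ// Normc.normc0 mul0e.
  by apply/funext => k; rewrite mul0r.
move=> c a b; rewrite !inE/= => fa fb.
apply: le_lt_trans (ces_normD (fun k => c * a k) b (ltW p1)) _.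
by rewrite lte_add_pinfty// ces_normZ// lte_mul_pinfty ?lee_fin ?normc_ge0.
Qed.

HB.instance Definition _ :=
  GRing.isSubmodClosed.Build R[i] (nat -> R[i]) (ces p) ces_submod_closed.
HB.instance Definition _ := [SubChoice_isSubLmodule of ces_dirichlet by <:].

Implicit Types g h : ces_dirichlet.

Definition ces_dirichlet_norm g : R[i] := (fine (ces_norm p g))%:C.

Lemma ces_norm_fine g : (fine (ces_norm p g))%:E = ces_norm p g.
Proof.
have := coef_ces g; rewrite inE/= => fg.
by rewrite fineK// ge0_fin_numE// ces_norm_ge0.
Qed.

Lemma ces_dirichlet_normD g h :
  ces_dirichlet_norm (g + h) <= ces_dirichlet_norm g + ces_dirichlet_norm h.
Proof.
rewrite /ces_dirichlet_norm -rmorphD lecR -lee_fin EFinD !ces_norm_fine.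
exact: ces_normD (ltW p1).
Qed.

Lemma ces_dirichlet_normZ (c : R[i]) g :
  ces_dirichlet_norm (c *: g) = `|c| * ces_dirichlet_norm g.
Proof.
rewrite /ces_dirichlet_norm (_ : `|c| = (Normc.normc c)%:C)//.
rewrite -rmorphM; congr (_%:C); apply: EFin_inj.
by rewrite EFinM !ces_norm_fine -ces_normZ ?(lt_trans ltr01).
Qed.

Lemma ces_dirichlet_norm_eq0 g : ces_dirichlet_norm g = 0 -> g = 0.
Proof.
move=> [] g0; apply: val_inj; apply/funext => n.
by apply: (@ces_norm_eq0 _ p); rewrite -ces_norm_fine g0.
Qed.

HB.instance Definition _ := Lmodule_isNormed.Build R[i] ces_dirichlet
  ces_dirichlet_normD ces_dirichlet_normZ ces_dirichlet_norm_eq0.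

End ces_dirichlet_normedModType.

(* q is the conjugate exponent of p. *)
Definition is_multiplier (R : realType) (p q : R) (p1 : 1 < p)
    (f : R[i] -> R[i]) :=
  analytic_on (half_plane q^-1) f /\
  forall g : ces_dirichlet p1, exists h : ces_dirichlet p1,
    forall s, half_plane q^-1 s ->
      dirichlet_series h s = f s * dirichlet_series g s.

(* M_f; well defined because a Dirichlet series that vanishes on a half-plane
   where it converges has zero coefficients. *)
Definition mult_op (R : realType) (p q : R) (p1 : 1 < p) (f : R[i] -> R[i])
    (fM : is_multiplier q p1 f) (g : ces_dirichlet p1) : ces_dirichlet p1 :=
  projT1 (cid (fM.2 g)).

Lemma mult_opE (R : realType) (p q : R) (p1 : 1 < p) (f : R[i] -> R[i])
    (fM : is_multiplier q p1 f) (g : ces_dirichlet p1) (s : R[i]) :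
  half_plane q^-1 s ->
  dirichlet_series (mult_op fM g) s = f s * dirichlet_series g s.
Proof. by move: s; exact: (projT2 (cid (fM.2 g))). Qed.

Definition compact_operator (K : numFieldType) (V W : normedModType K)
    (T : V -> W) :=
  precompact (T @` [set v | `|v| <= 1]).

(* Main.v *)
(* If f <> 0, let a_N be the first nonzero Dirichlet coefficient of f = M_f(1).
   For the normalized characters g_m = m^(-s) / ||m^(-s)||, the first nonzero
   coefficient of f g_m sits at m N and equals a_N / ||m^(-s)||; so each single
   coefficient of f g_m is eventually 0 as m grows. On the other hand, comparing
   the Cesaro means of f g_m along multiples of N with those of m^(-s) gives
   ||f g_m|| >= |a_N| / N. Hence the only possible cluster point of (f g_m) is 0,
   which the lower bound on the norms excludes. *)
Require Import Defs.
From mathcomp Require Import all_boot all_order all_algebra.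
From mathcomp Require Import complex.
From mathcomp Require Import all_classical all_reals all_analysis.
From mathcomp Require Import ring lra.
Import Order.TTheory GRing.Theory Num.Theory.
Import numFieldNormedType.Exports.
Local Open Scope ring_scope.
Local Open Scope complex_scope.

Section ces_multipliers.
Local Open Scope classical_set_scope.

(** * Tails of complex and real series *)

(** The bound gives absolute convergence, hence convergence of real and imaginary parts. So [limn]
    is a true limit, and the bound on partial sums minus the head passes to it. *)
Lemma complex_series_tail_le {R : realType} {u : nat -> R[i]} {N V} :
  (forall m, \sum_(N <= n < m) Normc.normc (u n) <= V) ->
  Normc.normc (limn (series u) - \sum_(n < N) u n) <= V.
Proof.
pose v n := Normc.normc (u n); move=> vV.
have v0 n : 0 <= v n := normc_ge0 (u n).
have vB m : \sum_(0 <= n < m) v n <= \sum_(0 <= n < N) v n + V.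
  case: (leqP N m) => Nm; first by rewrite (big_cat_nat _ (n := N))//= lerD2l.
  rewrite (big_cat_nat _ (n := m) (p := N))//= ?(ltnW Nm)//.
  rewrite -addrA lerDl addr_ge0 ?sumr_ge0//.
  by have := vV N; rewrite big_geq.
have cv (w : nat -> R) : (forall n, `|w n| <= v n) -> cvgn (series w).
  move=> wv; apply: normed_cvg.
  apply: (@nondecreasing_is_cvgn _ (series (fun n => `|w n|))).
    by apply: nondecreasing_series => n _ _.
  exists (\sum_(0 <= n < N) v n + V) => _ [m _ <-].
  by apply: le_trans (vB m); apply: ler_sum.
have normcE (z : R[i]) : `|z| = (Normc.normc z)%:C by [].
have ReV (z : R[i]) : `|complex.Re z| <= Normc.normc z.
  by rewrite -lecR -normcE normc_ge_Re.
have ImV (z : R[i]) : `|complex.Im z| <= Normc.normc z.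
  rewrite -sqrtr_sqr; case: z => x y /=; rewrite ler_sqrt ?addr_ge0 ?sqr_ge0//.
  by rewrite lerDr sqr_ge0.
have cx := cv (fun n => complex.Re (u n)) (fun n => ReV (u n)).
have cy := cv (fun n => complex.Im (u n)) (fun n => ImV (u n)).
set x := limn _ in cx; set y := limn _ in cy.
have seriesE m : series u m =
    series (fun n => complex.Re (u n)) m +i* series (fun n => complex.Im (u n)) m.
  rewrite /series/=; elim: m => [|m IH]; first by rewrite !big_geq.
  by rewrite !big_nat_recr//= IH; case: (u m).
have normcD1 (a b : R) : Normc.normc (a +i* b) <= `|a| + `|b|.
  rewrite -[leRHS]ger0_norm ?addr_ge0// -sqrtr_sqr /= ler_sqrt ?sqr_ge0//.
  by rewrite sqrrD !real_normK ?num_real// lerD2r lerDl mulrn_wge0// mulr_ge0.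
have cl : series u @ \oo --> x +i* y.
  (* A positive element of [R[i]] is a positive real, so the radius reduces to [e1]. *)
  apply/cvgrPdist_le => -[e1 e2]; rewrite ltcE/= => /andP[/eqP -> e0].
  have e20 : 0 < e1 / 2 by rewrite divr_gt0.
  move/cvgrPdist_le : cx => /(_ _ e20) cx.
  move/cvgrPdist_le : cy => /(_ _ e20) cy.
  near=> m; rewrite normcE seriesE lecR.
  apply: le_trans (normcD1 _ _) _; rewrite [leRHS]splitr.
  by apply: lerD; near: m.
rewrite (norm_cvg_lim cl).
apply/ler_addgt0Pr => e e0.
have e0' : (0 : R[i]) < e%:C by rewrite ltcR.
move/cvgrPdist_le : cl => /(_ _ e0')[M _ /(_ (maxn M N))].
rewrite /= leq_maxl => /(_ isT); rewrite normcE lecR => le1.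
rewrite -[_ +i* _](subrK (series u (maxn M N))) -addrA.
have le2 : Normc.normc (series u (maxn M N) - \sum_(n < N) u n) <= V.
  apply: le_trans (vV (maxn M N)); rewrite seriesEnat/=.
  rewrite -(big_mkord xpredT) (big_cat_nat _ (n := N) (p := maxn M N))//= ?leq_maxr//.
  rewrite addrAC subrr add0r.
  elim/big_ind2 : _ => [|z1 w1 z2 w2 h1 h2|n _]//; first by rewrite Normc.normc0.
  exact: le_trans (le_normcD _ _) (lerD h1 h2).
by apply: le_trans (le_normcD _ _) _; rewrite [leRHS]addrC; apply: lerD.
Unshelve. all: by end_near.
Qed.

(** Telescoping: 1/(k+2)^2 <= 1/(k+1) - 1/(k+2). The bound does not depend on the range of
    summation. *)
Lemma sum_sqrV_le {R : realType} (m n : nat) :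
  \sum_(m <= k < n) k.+1%:R ^- 2 <= 2 :> R.
Proof.
have pos k : 0 <= k.+1%:R ^- 2 :> R by rewrite invr_ge0 exprn_ge0.
have step k : k.+2%:R ^- 2 <= k.+1%:R^-1 - k.+2%:R^-1 :> R.
  have k1 : k.+1%:R != 0 :> R by rewrite pnatr_eq0.
  have k2 : k.+2%:R != 0 :> R by rewrite pnatr_eq0.
  have -> : k.+1%:R^-1 - k.+2%:R^-1 = (k.+1%:R * k.+2%:R)^-1 :> R.
    rewrite -[k.+2%:R]natr1; field.
    by rewrite !nat1r natr1 k1 k2.
  rewrite lef_pV2 ?posrE ?exprn_gt0 ?mulr_gt0 ?ltr0n// expr2 ler_wpM2r//.
  by rewrite ler_nat.
have tot l : \sum_(0 <= k < l.+1) k.+1%:R ^- 2 <= 2 - l.+1%:R^-1 :> R.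
  elim: l => [|l IH]; first by rewrite big_nat1 expr1n !invr1; lra.
  rewrite big_nat_recr//=; apply: le_trans (lerD IH (step l)) _.
  by rewrite addrA subrK.
case: (leqP m n) => mn; last by rewrite big_geq//; exact: ltnW.
apply: (@le_trans _ _ (\sum_(0 <= k < n.+1) k.+1%:R ^- 2)).
  rewrite (big_cat_nat _ (n := m) (p := n.+1))//=; last exact: leqW.
  by rewrite [X in _ <= _ + X]big_nat_recr//= addrCA lerDl addr_ge0 ?sumr_ge0.
by apply: le_trans (tot n) _; rewrite lerBlDr lerDl invr_ge0.
Qed.

(** * Recovery of coefficients from values at integers *)

Lemma dirichlet_char_nat {R : realType} (n j : nat) :
  dirichlet_char n.+1 j%:R = (n.+1%:R ^- j : R)%:C.
Proof.
rewrite /dirichlet_char /cexp.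
have -> : - j%:R * (ln n.+1%:R)%:C = (- (j%:R * ln n.+1%:R))%:C :> R[i].
  by rewrite rmorphN rmorphM/= rmorph_nat mulNr.
rewrite /= cos0 sin0 expRN expRM_natl lnK ?posrE//; exact: mulr1.
Qed.

Lemma normc_real {R : realType} (x : R) : 0 <= x -> Normc.normc x%:C = x.
Proof. by move=> x0; rewrite /= expr0n addr0 sqrtr_sqr ger0_norm. Qed.

(* [|a n| <= C (n+1)] only yields convergence for [Re s > 2]: hence the exponents
   [j.+3]. *)
Lemma dirichlet_leading_coef {R : realType} {C : R} {a : nat -> R[i]} {N : nat} :
  (forall n, Normc.normc (a n) <= C * n.+1%:R) ->
  (forall n, (n < N)%N -> a n = 0) ->
  (fun j => N.+1%:R ^+ j.+3 * dirichlet_series a j.+3%:R) @ \oo --> a N.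
Proof.
move=> aC a0.
have C0 : 0 <= C.
  by have := le_trans (normc_ge0 _) (aC 0); rewrite mulr1.
(* Ratio of the leading base to the next one; after rescaling, the tail decays like [r ^+ j]. *)
pose r : R := N.+1%:R / N.+2%:R.
have natC (k j : nat) : k%:R ^+ j = (k%:R ^+ j : R)%:C :> R[i].
  by rewrite rmorphXn/= rmorph_nat.
(* Of the [j.+3] powers of 1/(n+1), one absorbs the growth of [a], two make the sum converge, and
   [j] are bounded through n+1 >= N+2. *)
have tail j m : \sum_(N.+1 <= n < m)
    Normc.normc (a n * dirichlet_char n.+1 j.+3%:R) <= N.+2%:R ^- j * C * 2.
  apply: (@le_trans _ _
    (\sum_(N.+1 <= n < m) N.+2%:R ^- j * C * n.+1%:R ^- 2)); last first.
    by rewrite -mulr_sumr ler_wpM2l ?sum_sqrV_le// mulr_ge0.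
  rewrite big_nat_cond [leRHS]big_nat_cond; apply: ler_sum => n.
  move=> /andP[/andP[Nn _] _].
  have n0 : n.+1%:R != 0 :> R by rewrite pnatr_eq0.
  rewrite dirichlet_char_nat Normc.normcM normc_real ?invr_ge0 ?exprn_ge0//.
  apply: (@le_trans _ _ (C * n.+1%:R * n.+1%:R ^- j.+3)).
    by apply: ler_wpM2r => //; rewrite invr_ge0 exprn_ge0.
  have -> : C * n.+1%:R * n.+1%:R ^- j.+3 = n.+1%:R ^- j * C * n.+1%:R ^- 2.
    by rewrite -addn3 exprD; field; rewrite nat1r n0 expf_neq0.
  rewrite ler_wpM2r ?invr_ge0 ?exprn_ge0// ler_wpM2r//.
  by rewrite lef_pV2 ?posrE ?exprn_gt0// lerXn2r ?nnegrE// ler_nat.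
have est j : `|a N - N.+1%:R ^+ j.+3 * dirichlet_series a j.+3%:R| <=
    (geometric (N.+1%:R ^+ 3 * C * 2) r j)%:C.
  have := complex_series_tail_le (tail j).
  rewrite big_ord_recr/= big1 ?add0r; last first.
    by move=> i _; rewrite a0// mul0r.
  rewrite -/(dirichlet_series a _) dirichlet_char_nat.
  move: (dirichlet_series _ _) => F.
  rewrite -(ler_pM2l (x := N.+1%:R ^+ j.+3)) ?exprn_gt0// => le1.
  rewrite distrC (_ : `|_| = (Normc.normc
    (N.+1%:R ^+ j.+3 * F - a N))%:C)// lecR.
  have e1 : N.+1%:R ^+ j.+3 * (N.+2%:R ^- j * C * 2) =
      N.+1%:R ^+ 3 * C * 2 * r ^+ j.
    have n0 : N.+2%:R != 0 :> R by rewrite pnatr_eq0.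
    by rewrite /r expr_div_n -addn3 exprD; field.
  rewrite [leRHS]/= -e1; apply: le_trans le1.
  rewrite -[X in _ <= X * _](normc_real (N.+1%:R ^+ j.+3)) ?exprn_ge0//.
  rewrite -Normc.normcM natC mulrBr mulrCA -rmorphM/= mulfV ?expf_neq0 ?pnatr_eq0//.
  by rewrite mulr1.
have r1 : `|r| < 1.
  by rewrite ger0_norm ?divr_ge0// ltr_pdivrMr// mul1r ltr_nat.
have /cvgrPdist_le g0 := cvg_geometric (N.+1%:R ^+ 3 * C * 2) r1.
apply/cvgrPdist_le => -[e1 e2]; rewrite ltcE/= => /andP[/eqP -> e0].
near=> j; apply: le_trans (est j) _; rewrite lecR.
apply: le_trans (ler_norm _) _; rewrite -normrN -sub0r.
near: j; exact: g0.
Unshelve. all: by end_near.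
Qed.

(* With indices from 0, [m * N.+1 + N] is the position of (m+1)(N+1). *)
Lemma dirichlet_dilation_coef {R : realType} {C C' : R} {a b : nat -> R[i]}
    {N m : nat} {l : R[i]} :
  (forall n, Normc.normc (a n) <= C * n.+1%:R) ->
  (forall n, Normc.normc (b n) <= C' * n.+1%:R) ->
  (forall n, (n < N)%N -> a n = 0) ->
  (forall j, dirichlet_series b j.+3%:R =
    l * m.+1%:R ^- j.+3 * dirichlet_series a j.+3%:R) ->
  (forall n, (n < m * N.+1 + N)%N -> b n = 0) /\
  b (m * N.+1 + N)%N = l * a N.
Proof.
move=> aC bC a0 ba.
have lim_a := dirichlet_leading_coef aC a0.
have M1 : (m * N.+1 + N).+1 = (m.+1 * N.+1)%N by rewrite -addnS -mulSnr.
have b0 n : (n < m * N.+1 + N)%N -> b n = 0.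
  (* Once the earlier coefficients vanish, (n+1)^(j+3) times the series of [b] tends to [b n]. By
     [ba] it is also [r ^+ j.+3] times a convergent sequence, with [r < 1]. *)
  elim/ltn_ind: n => n IH nM.
  have lim_b := dirichlet_leading_coef bC (fun k kn => IH k kn (ltn_trans kn nM)).
  pose r : R := n.+1%:R / (m.+1 * N.+1)%:R.
  have r0 : 0 <= r by rewrite divr_ge0.
  have r_lt1 : r < 1 by rewrite ltr_pdivrMr ?ltr0n// mul1r ltr_nat -M1 ltnS.
  have r1 : `|r| < 1 by rewrite ger0_norm.
  have lim_r : (fun j => (r ^+ j.+3)%:C : R[i]) @ \oo --> (0 : R[i]).
    have /cvgrPdist_le g0 := cvg_expr r1.
    apply/cvgrPdist_le => -[e1 e2]; rewrite ltcE/= => /andP[/eqP -> e0].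
    near=> j; rewrite sub0r normrN.
    have rj0 : 0 <= r ^+ j by rewrite exprn_ge0.
    rewrite (_ : `|_| = (Normc.normc (r ^+ j.+3)%:C)%:C)// lecR.
    rewrite normc_real ?exprn_ge0// -addn3 exprD.
    apply: (@le_trans _ _ (r ^+ j)).
      by rewrite ler_piMr// exprn_ile1// ltW.
    by rewrite -(ger0_norm rj0) -normrN -sub0r; near: j; exact: g0.
  have := cvgM lim_r (cvgM (cvg_cst l) lim_a); rewrite mul0r => lim0.
  have bE j : n.+1%:R ^+ j.+3 * dirichlet_series b j.+3%:R = (r ^+ j.+3)%:C *
      (l * (N.+1%:R ^+ j.+3 * dirichlet_series a j.+3%:R)).
    rewrite ba /r natrM rmorphXn/= fmorph_div/= rmorphM/= !rmorph_nat.
    by rewrite expr_div_n exprMn; field; rewrite !expf_neq0 ?pnatr_eq0.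
  rewrite (funext bE) in lim_b.
  exact: (cvg_unique (@norm_hausdorff _ _) lim_b (lim0 _ _ _)).
split=> //.
(* At the base (m+1)(N+1) the powers of m+1 cancel exactly, which leaves the limit [l * a N]. *)
have := dirichlet_leading_coef (N := (m * N.+1 + N)%N) bC.
rewrite M1 => /(_ b0) lim_b.
have lim_la := cvgM (cvg_cst l) lim_a.
have bE j : (m.+1 * N.+1)%:R ^+ j.+3 * dirichlet_series b j.+3%:R =
    l * (N.+1%:R ^+ j.+3 * dirichlet_series a j.+3%:R).
  by rewrite ba natrM exprMn; field; rewrite !expf_neq0 ?pnatr_eq0.
rewrite (funext bE) in lim_b.
exact: (cvg_unique (@norm_hausdorff _ _) lim_b (lim_la _ _)).
Unshelve. all: by end_near.
Qed.

(** * Estimates for the norm of ces_p *)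

(** A coefficient is at most n+1 times its Cesaro mean, and each mean is at most the norm. This
    yields both the linear growth needed above and the continuity of coefficients. *)
Lemma normc_le_ces_norm {R : realType} {p : R} {p1 : 1 < p} (g : ces_dirichlet p1) n :
  Normc.normc (g n) <= fine (ces_norm p g) * n.+1%:R.
Proof.
have p0 : 0 < p := lt_trans ltr01 p1.
have le1 : ces_mean g n <= fine (ces_norm p g).
  rewrite -lee_fin ces_norm_fine /ces_norm.
  have -> : ces_mean g n = (ces_mean g n `^ p) `^ p^-1.
    by rewrite -powRrM mulfV ?gt_eqF// powRr1 ?ces_mean_ge0.
  rewrite -poweR_EFin; apply: gt0_ler_poweR.
  - by rewrite invr_ge0 ltW.
  - by rewrite in_itv/= leey lee_fin powR_ge0.
  - by rewrite in_itv/= leey andbT nneseries_ge0// => k *; rewrite lee_fin powR_ge0.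
  apply: le_trans (nneseries_lim_ge n.+1 _); last first.
    by move=> k _ _; rewrite lee_fin powR_ge0.
  by rewrite big_nat_recr//= leeDr// sume_ge0// => k _; rewrite lee_fin powR_ge0.
rewrite -ler_pdivrMr ?ltr0n//; apply: le_trans le1.
rewrite /ces_mean mulrC ler_wpM2l ?invr_ge0// big_ord_recr/= lerDr.
by rewrite sumr_ge0// => k _; exact: normc_ge0.
Qed.

(** Cut the sum for [a] into blocks of length [K.+1] and keep only the last term of each. *)
Lemma ces_norm_le_dilation {R : realType} {p : R} {a b : nat -> R[i]} (K : nat) :
  0 < p ->
  (forall n, ces_mean b n <= ces_mean a (n * K.+1 + K)) ->
  (ces_norm p b <= ces_norm p a)%E.
Proof.
move=> p0 ba.
have t0 (c : nat -> R[i]) n : (0 <= (ces_mean c n `^ p)%:E)%E.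
  by rewrite lee_fin powR_ge0.
apply: gt0_ler_poweR.
- by rewrite invr_ge0 ltW.
- by rewrite in_itv/= leey andbT nneseries_ge0.
- by rewrite in_itv/= leey andbT nneseries_ge0.
apply: lime_le; first exact: is_cvg_nneseries.
near=> n.
apply: le_trans (nneseries_lim_ge (n * K.+1) _); last by [].
rewrite big_nat_mul; apply: lee_sum => i _.
rewrite mulSnr addnS big_nat_recr ?leq_addr//=.
rewrite -[leLHS]add0e leeD ?sume_ge0// lee_fin ge0_ler_powR ?nnegrE ?ces_mean_ge0//.
exact: ltW.
Unshelve. all: by end_near.
Qed.

(** * Characters as elements of H(ces_p) *)

Lemma ces_mean_delta {R : realType} (m n : nat) :
  ces_mean (fun k => (k == m)%:R : R[i]) n = if (m <= n)%N then n.+1%:R^-1 else 0.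
Proof.
rewrite /ces_mean; case: leqP => mn.
  rewrite (bigD1 (inord m))//= inordK// eqxx Normc.normc1 big1 ?addr0 ?mulr1//.
  move=> k /eqP km; case: eqP => [kme|]; last by rewrite Normc.normc0.
  by case: km; apply: val_inj; rewrite /= inordK.
rewrite big1 ?mulr0// => k _.
by rewrite (ltn_eqF (leq_trans (ltn_ord k) mn)) Normc.normc0.
Qed.

(** Pairing terms gives A(2m+1) <= 1 + 2^(1-p) A(m) for the partial sums; since A(m) <= A(2m+1) and
    2^(1-p) < 1, this can be solved for A(m). *)
Lemma p_series_bounded {R : realType} {p : R} (p1 : 1 < p) (m : nat) :
  \sum_(0 <= n < m) n.+1%:R^-1 `^ p <= (1 - 2 * 2^-1 `^ p)^-1 :> R.
Proof.
have p0 : 0 < p := lt_trans ltr01 p1.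
pose t n : R := n.+1%:R^-1 `^ p.
have t_anti n k : (n <= k)%N -> t k <= t n.
  move=> nk; apply: ge0_ler_powR; rewrite ?nnegrE ?invr_ge0 ?(ltW p0)//.
  by rewrite lef_pV2 ?posrE// ler_nat.
pose A m := \sum_(0 <= n < m) t n; change (A m <= (1 - 2 * 2^-1 `^ p)^-1).
have r_lt1 : 2 * 2^-1 `^ p < 1.
  rewrite -ltr_pdivlMl// mulr1 /powR invr_eq0 pnatr_eq0/=.
  rewrite -[ltRHS]lnK ?posrE ?invr_gt0// ltr_expR lnV ?posrE// mulrN ltrN2.
  by rewrite ltr_pMl// ln_gt0// ltr1n.
(* (2k)^-p + (2k+1)^-p <= 2 (2k)^-p = 2^(1-p) k^-p *)
have A2 k : A k.*2.+1 <= 1 + 2 * 2^-1 `^ p * A k.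
  elim: k => [|k IH].
    by rewrite /A big_nat1 big_geq// mulr0 addr0 /t invr1 powR1.
  rewrite doubleS /A big_nat_recr//= big_nat_recr//=.
  rewrite [X in _ <= _ + _ * X]big_nat_recr//=.
  have th : t k.*2.+1 = 2^-1 `^ p * t k.
    by rewrite /t -powRM ?invr_ge0// -invfM -natrM mul2n doubleS.
  rewrite mulrDr addrA -addrA lerD//.
  by rewrite -mulrA -th mulr_natl mulr2n lerD2l t_anti.
have le1 : A m <= 1 + 2 * 2^-1 `^ p * A m.
  apply: le_trans (A2 m); rewrite /A [leRHS](big_cat_nat _ (n := m))//=.
    by rewrite lerDl sumr_ge0// => i _; exact: powR_ge0.
  by rewrite leqW// -addnn leq_addr.
by rewrite -[leRHS]mul1r ler_pdivlMr ?subr_gt0// mulrBr mulr1 lerBlDr mulrC.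
Qed.

Lemma delta_ces {R : realType} {p : R} (p1 : 1 < p) (m : nat) :
  (fun k => (k == m)%:R : R[i]) \in ces p.
Proof.
have p0 : 0 < p := lt_trans ltr01 p1.
rewrite inE/=; apply: poweR_lty.
apply: (@le_lt_trans _ _ ((1 - 2 * 2^-1 `^ p)^-1)%:E); last exact: ltry.
apply: lime_le.
  by apply: is_cvg_nneseries => n _ _; rewrite lee_fin powR_ge0.
apply: nearW => n; rewrite sumEFin lee_fin; apply: le_trans (p_series_bounded p1 n).
apply: ler_sum => k _; apply: ge0_ler_powR; rewrite ?nnegrE ?ces_mean_ge0 ?(ltW p0)//.
by rewrite ces_mean_delta; case: ifP.
Qed.

(** The tail estimate with bound 0 identifies the limit with a partial sum. The scalar [c] serves
    the normalized characters and, at [c = 0], the zero series. *)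
Lemma dirichlet_series_delta {R : realType} (c : R[i]) m s :
  dirichlet_series (fun k => c * (k == m)%:R) s = c * dirichlet_char m.+1 s.
Proof.
pose u (n : nat) : R[i] := c * (n == m)%:R * dirichlet_char n.+1 s.
have u0 n : n != m -> u n = 0 by rewrite /u => /negbTE ->; rewrite mulr0 mul0r.
have tail M : \sum_(m.+1 <= n < M) Normc.normc (u n) <= 0.
  rewrite big_nat_cond big1// => n /andP[/andP[mn _] _].
  by rewrite u0 ?gtn_eqF// Normc.normc0.
have := complex_series_tail_le tail.
rewrite big_ord_recr/= big1 ?add0r; last first.
  by move=> n _; rewrite u0 ?ltn_eqF.
rewrite {2}/u eqxx mulr1 => le0; apply/subr0_eq/Normc.eq0_normc/eqP.
by rewrite eq_le le0 normc_ge0.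
Qed.

Definition delta_dirichlet {R : realType} {p : R} (p1 : 1 < p) (m : nat) :=
  CesDirichlet p1 (delta_ces p1 m).

(** * Compactness against a lower bound on norms *)

(** The sequence [b] has a cluster point. Its coefficients are limits of zeros, so it is 0; if
    [c > 0], no [b m] comes within [c] of it. *)
Lemma precompact_vanishing_coef_le0 {R : realType} {p : R} {p1 : 1 < p}
    {b : nat -> ces_dirichlet p1} {K : set (ces_dirichlet p1)} {c : R} :
  precompact K -> (forall m, K (b m)) -> (forall m n, (n < m)%N -> b m n = 0) ->
  (forall m, c <= fine (ces_norm p (b m))) -> c <= 0.
Proof.
rewrite precompactE => cK Kb b0 bc; rewrite leNgt; apply/negP => c0.
have [|h [_ clh]] := cK (b @ \oo) _.
  by exists 0%N => // m _ /=; apply: subset_closure.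
(* Clustering in usable form: whatever holds eventually along [b] holds at points arbitrarily near
   [h]. *)
have close (e : R) (A : set (ces_dirichlet p1)) :
    0 < e -> (\forall m \near \oo, A (b m)) ->
    exists2 g, A g & fine (ces_norm p (h - g)) < e.
  move=> e0 Ab; have e0' : (0 : R[i]) < e%:C by rewrite ltcR.
  have near_h : \forall g \near h, `|h - g| < e%:C.
    by apply/nbhs_normP; exists e%:C.
  have [g [Ag hg]] := clh A _ Ab near_h.
  by exists g => //; move: hg; rewrite /= -ltcR.
have h0 : h = 0.
  apply: val_inj; apply/funext => n; apply: Normc.eq0_normc; apply/eqP.
  rewrite eq_le normc_ge0 andbT; apply/ler_addgt0Pr => e e0; rewrite add0r.
  have [||g gn hg] := close (e / n.+1%:R) [set g | g n = 0].
  - by rewrite divr_gt0.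
  - by exists n.+1 => // m /= nm; exact: b0.
  have := normc_le_ces_norm (h - g) n.
  have -> : (h - g) n = h n - g n by [].
  rewrite gn subr0 => /le_trans; apply.
  by rewrite -ler_pdivlMr// ltW.
have [|g gc] := close c [set g | c <= fine (ces_norm p g)] c0; first exact: nearW.
rewrite h0 sub0r.
have -> : fine (ces_norm p (- g)) = fine (ces_norm p g).
  by have := normrN g => -[].
by rewrite ltNge gc.
Qed.

Lemma ces_norm_delta_gt0 {R : realType} {p : R} (p1 : 1 < p) (m : nat) :
  0 < fine (ces_norm p (delta_dirichlet p1 m)).
Proof.
have := normc_le_ces_norm (delta_dirichlet p1 m) m.
rewrite /= eqxx Normc.normc1 => le1.
by rewrite -(pmulr_lgt0 _ (ltr0Sn R m)) (lt_le_trans ltr01).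
Qed.

(** For n >= m, the mean of order (n+1)(N+1) includes the coefficient at (m+1)(N+1), so it is at
    least [c] times the mean 1/(n+1) of the character. *)
Lemma ces_norm_dilation_ge {R : realType} {p : R} (p1 : 1 < p)
    (b : ces_dirichlet p1) (m N : nat) :
  Normc.normc (b (m * N.+1 + N)%N) / N.+1%:R *
    fine (ces_norm p (delta_dirichlet p1 m)) <= fine (ces_norm p b).
Proof.
have p0 : 0 < p := lt_trans ltr01 p1.
set c := _ / _.
have c0 : 0 <= c by rewrite divr_ge0// normc_ge0.
rewrite -lee_fin EFinM !ces_norm_fine -(normc_real c)// -ces_normZ//.
apply: (ces_norm_le_dilation N) => // n.
rewrite ces_meanZ ces_mean_delta normc_real//.
case: leqP => [mn|_]; last by rewrite mulr0 ces_mean_ge0.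
have M1 : (n * N.+1 + N).+1 = (n.+1 * N.+1)%N by rewrite -addnS -mulSnr.
have le_mn : (m * N.+1 + N < (n * N.+1 + N).+1)%N.
  by rewrite ltnS leq_add2r leq_mul2r mn orbT.
rewrite /ces_mean /c (bigD1 (Ordinal le_mn))//= mulrDr.
rewrite -[leLHS]addr0 lerD//.
  by rewrite M1 natrM invfM mulrC mulrA mulrAC mulrC.
by rewrite mulr_ge0 ?invr_ge0// sumr_ge0// => k _; exact: normc_ge0.
Qed.

End ces_multipliers.

Theorem theorem5p1 (R : realType) (p q : R) (p1 : 1 < p)
    (pq : p^-1 + q^-1 = 1) (f : R[i] -> R[i]) (fM : is_multiplier q p1 f) :
  compact_operator (mult_op fM) ->
  forall s : R[i], half_plane q^-1 s -> f s = 0.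
Proof.
move=> cT s hs.
pose e m := delta_dirichlet p1 m; pose ce m := fine (ces_norm p (e m)).
have ce0 m : 0 < ce m := ces_norm_delta_gt0 p1 m.
pose l m : R[i] := ((ce m)^-1)%:C.
pose a := mult_op fM (e 0); pose b m := mult_op fM (l m *: e m).
have half j : half_plane q^-1 (j.+3%:R : R[i]).
  rewrite /half_plane /= -(rmorph_nat (real_complex R)) /=.
  have : q^-1 <= 1 by rewrite -pq lerDr invr_ge0 ltW// (lt_trans ltr01).
  by move=> /le_lt_trans; apply; rewrite ltr1n.
(* [e 0] is the constant function 1, so [a] holds the coefficients of [f] itself. *)
have fa t : half_plane q^-1 t -> f t = dirichlet_series a t.
  move=> ht; rewrite /a mult_opE//.
  have -> : dirichlet_series (e 0) t = 1 * dirichlet_char 1 t.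
    rewrite -(dirichlet_series_delta 1 0); congr dirichlet_series.
    by apply/funext => k; rewrite mul1r.
  rewrite /dirichlet_char ln1 mulr0 /cexp /= expR0 cos0 sin0.
  by rewrite mul1r !mulr1.
have [a0|] := pselect (forall n, a n = 0).
  have := dirichlet_series_delta 0 0 s; rewrite mul0r fa// => <-.
  by congr dirichlet_series; apply/funext => n; rewrite a0 mul0r.
move=> /existsNP[n /eqP an].
have [N aN Nmin] := ex_minnP (ex_intro (fun n => a n != 0) n an).
have aN0 k : (k < N)%N -> a k = 0.
  by move=> kN; apply/eqP/negPn/negP => /Nmin; rewrite leqNgt kN.
have ba m j : dirichlet_series (b m) j.+3%:R =
    l m * m.+1%:R ^- j.+3 * dirichlet_series a j.+3%:R.
  rewrite /b mult_opE// fa//.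
  have -> : dirichlet_series (l m *: e m) j.+3%:R = l m * dirichlet_char m.+1 j.+3%:R.
    exact: dirichlet_series_delta.
  by rewrite dirichlet_char_nat fmorphV rmorphXn/= rmorph_nat mulrC.
have bN m := dirichlet_dilation_coef (normc_le_ces_norm a)
  (normc_le_ces_norm (b m)) aN0 (ba m).
suff : Normc.normc (a N) / N.+1%:R <= 0.
  rewrite pmulr_lle0 ?invr_gt0// => aN_le0; case/negP: aN; apply/eqP.
  by apply/Normc.eq0_normc/eqP; rewrite eq_le aN_le0 normc_ge0.
(* The inputs [l m *: e m] have norm exactly 1; coefficients below [m] vanish because m <= m(N+1)+N;
   in the lower bound the factor [l m] cancels [ce m]. *)
apply: (precompact_vanishing_coef_le0 (b := b) cT) => [m|m k km|m].
- exists (l m *: e m) => //=.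
  rewrite normrZ (_ : `|e m| = (ce m)%:C)// (_ : `|l m| = (Normc.normc (l m))%:C)//.
  by rewrite normc_real ?invr_ge0 ?(ltW (ce0 m))// -rmorphM/= mulVf ?gt_eqF.
- by apply: (bN m).1; rewrite (leq_trans km)// mulnS -addnA leq_addr.
- apply: le_trans (ces_norm_dilation_ge p1 (b m) m N); rewrite (bN m).2.
  rewrite Normc.normcM normc_real ?invr_ge0 ?(ltW (ce0 m))//.
  suff -> : (ce m)^-1 * Normc.normc (a N) / N.+1%:R * ce m =
      Normc.normc (a N) / N.+1%:R by [].
  by field; rewrite nat1r pnatr_eq0 (gt_eqF (ce0 m)).
Qed.
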